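(* Let $f$ be a combining function satisfying monotonicity and symmetry (A0). Let $\ell_\alpha^+(\cdot),\ell_\alpha^-(\cdot)$ be the directional closed testing lower bounds and $\tilde\ell_\alpha^+(\cdot),\tilde\ell_\alpha^-(\cdot)$ the bounds obtained from the partitioning procedure with the level $\alpha$ adaptive local tests, both using $f$ and the same level $\alpha$. Then for every $\mathcal I\subseteq[n]$, $$\tilde\ell_\alpha^+(\mathcal I)\ge\ell_\alpha^+(\mathcal I)\qquad\text{and}\qquad\tilde\ell_\alpha^-(\mathcal I)\ge\ell_\alpha^-(\mathcal I).$$ Moreover, if $\mathcal I\subseteq\mathcal S^-$ then $\tilde\ell_\alpha^+(\mathcal I)=\ell_\alpha^+(\mathcal I)$ and $\tilde\ell_\alpha^-(\mathcal I)=\ell_\alpha^-(\mathcal I)=0$; and if $\mathcal I\subseteq\mathcal S^+$ then $\tilde\ell_\alpha^-(\mathcal I)=\ell_\alpha^-(\mathcal I)$ and $\tilde\ell_\alpha^+(\mathcal I)=\ell_\alpha^+(\mathcal I)=0$.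
   Context: Setting. $[n]=\{1,\ldots,n\}$, $\alpha\in(0,1)$; $p_1,\ldots,p_n\in[0,1]$ are the observed $p$-values (for $\theta_i\le 0$) and $q_i=1-p_i$ (for $\theta_i\ge 0$). $\mathcal S^-=\{i:p_i\le 1/2\}$, $\mathcal S^+=\{i:p_i>1/2\}$. The statement holds for every realization of the $p$-values. Combining function. $f$ is a family of functions $f:[0,1]^d\to[0,1]$, $d\ge 1$, with the convention $f(\emptyset)=1$. (A0): for every $d$, $f(x_1,\ldots,x_d)\le f(x'_1,\ldots,x'_d)$ whenever $x_i\le x'_i$ for all $i$, and $f$ is invariant under permutations of its arguments. Local tests. For $\mathcal I\subseteq[n]$, $\phi_{\mathcal I}=\mathbf 1\{f(\{2p_i,i\in\mathcal I\cap\mathcal S^-\}\cup\{2q_j,j\in\mathcal I\cap\mathcal S^+\})\le\alpha\}$ (collections taken with multiplicity), so $\phi_\emptyset=0$. Directional closed testing (DCT) bounds. $\bar\phi_{\mathcal I}=\min\{\phi_{\mathcal J}:\mathcal I\subseteq\mathcal J\subseteq[n]\}$, $\ell_\alpha(\mathcal I)=\min\{|\mathcal I\setminus\mathcal J|:\mathcal J\subseteq\mathcal I,\bar\phi_{\mathcal J}=0\}$, $\ell_\alpha^+(\mathcal I)=\ell_\alpha(\mathcal I\cap\mathcal S^-)$, $\ell_\alpha^-(\mathcal I)=\ell_\alpha(\mathcal I\cap\mathcal S^+)$. Partitioning bounds. For $\mathcal K\subseteq[n]$, the adaptive local test is $\psi_{\mathcal K}=\phi_{(\mathcal K^c\cap\mathcal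 S^-)\cup(\mathcal K\cap\mathcal S^+)}$. Put $\psi_v(\mathcal I)=\min\{\psi_{\mathcal K}:\mathcal K\subseteq[n],|\mathcal K\cap\mathcal I|=v\}$, $\mathcal N^+(\mathcal I)_\alpha=\{v\in\{0,\ldots,|\mathcal I|\}:\psi_v(\mathcal I)=0\}$, $\tilde\ell_\alpha^+(\mathcal I)=\min\mathcal N^+(\mathcal I)_\alpha$, $\tilde\ell_\alpha^-(\mathcal I)=|\mathcal I|-\max\mathcal N^+(\mathcal I)_\alpha$. *)

(* Defs.v *)
From HB Require Import structures.
From mathcomp Require Import all_boot all_order all_algebra.
From mathcomp Require Import perm reals.

Set Implicit Arguments.
Unset Strict Implicit.
Unset Printing Implicit Defensive.

Import Order.TTheory GRing.Theory Num.Theory.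
Local Open Scope ring_scope.

Definition in_unit_cube (R : realType) (d : nat) (x : d.-tuple R) : Prop :=
  forall i : 'I_d, 0 <= tnth x i <= 1.

(** A family of maps [0,1]^d -> [0,1] is encoded by total maps R^d -> R that
    are only constrained (and, below, only evaluated) on the unit cube.  The
    component d = 0 carries the convention for the empty collection. *)
Record combining_function (R : realType) := CombiningFunction {
  combine :> forall d : nat, d.-tuple R -> R;
  combine_unit : forall (d : nat) (x : d.-tuple R),
    (1 <= d)%N -> in_unit_cube x -> 0 <= combine x <= 1;
  combine_nil : combine [tuple] = 1
}.

Definition monotone_cf (R : realType) (f : combining_function R) : Prop :=
  forall (d : nat) (x x' : d.-tuple R), in_unit_cube x -> in_unit_cube x' ->
    (forall i : 'I_d, tnth x i <= tnth x' i) -> f d x <= f d x'.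

Definition symmetric_cf (R : realType) (f : combining_function R) : Prop :=
  forall (d : nat) (x : d.-tuple R) (s : 'S_d), in_unit_cube x ->
    f d [tuple tnth x (s i) | i < d] = f d x.

Definition A0 (R : realType) (f : combining_function R) : Prop :=
  monotone_cf f /\ symmetric_cf f.

Section Bounds.
Variables (R : realType) (n : nat).
Variables (f : combining_function R) (alpha : R) (p : 'I_n -> R).
Implicit Types I J K : {set 'I_n}.

Definition Sminus : {set 'I_n} := [set i | p i <= 1 / 2].
Definition Splus : {set 'I_n} := [set i | 1 / 2 < p i].

(** The collection {2 p_i} U {2 q_j}, with multiplicities, listed in some
    order; the order is immaterial for a symmetric f. *)
Definition local_args I : seq R :=
  [seq 2 * p i | i <- enum (I :&: Sminus)] ++
  [seq 2 * (1 - p j) | j <- enum (I :&: Splus)].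

(** Indicators take values in nat, through the coercion of bool to nat. *)
Definition phi I : nat := (f _ (in_tuple (local_args I)) <= alpha)%R.

(** Minima are iterated [minn]s whose initial value is an upper bound of all
    the values the minimized quantity can take, so that it does not affect the
    minimum over a nonempty range.  All ranges below are nonempty when
    alpha < 1 and v <= #|I|: phi set0 = 0, and psi Sminus = phi set0. *)
Definition phi_bar I : nat :=
  \big[minn/1%N]_(J : {set 'I_n} | I \subset J) phi J.

Definition ell I : nat :=
  \big[minn/#|I|]_(J : {set 'I_n} | (J \subset I) && (phi_bar J == 0%N))
    #|I :\: J|.

Definition ell_plus I : nat := ell (I :&: Sminus).
Definition ell_minus I : nat := ell (I :&: Splus).

Definition psi K : nat := phi ((~: K :&: Sminus) :|: (K :&: Splus)).

Definition psi_count (v : nat) I : nat :=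
  \big[minn/1%N]_(K : {set 'I_n} | #|K :&: I| == v) psi K.

Definition Nplus I : {set 'I_(#|I|.+1)} :=
  [set v : 'I_(#|I|.+1) | psi_count v I == 0%N].

Definition tell_plus I : nat := \big[minn/#|I|]_(v in Nplus I) (v : nat).
Definition tell_minus I : nat := (#|I| - \max_(v in Nplus I) v)%N.

End Bounds.

(* Main.v *)
(** The adaptive test satisfies [psi K = phi (adapt K)] for an involution
    [adapt] of the subsets.  Hence all four bounds are minima over the sets [A]
    that are not rejected by [phi]:
    [ell_plus I] of [#|(I :&: S^-) :\: A|], [ell_minus I] of
    [#|(I :&: S^+) :\: A|], [tell_plus I] of [#|adapt A :&: I|] and
    [tell_minus I] of [#|I :\: adapt A|].  For each [A] the sets counted by the
    [ell]'s are included in those counted by the [tell]'s, with equality when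
    [I] lies on the relevant side.  On the other side the bounds vanish because
    [set0] is never rejected. *)
Require Import Defs.
From HB Require Import structures.
From mathcomp Require Import all_boot all_order all_algebra.
From mathcomp Require Import reals.

Set Implicit Arguments.
Unset Strict Implicit.
Unset Printing Implicit Defensive.

Import Order.TTheory GRing.Theory Num.Theory.
Local Open Scope ring_scope.

Lemma bigminn_leq (T : finType) (x : nat) (P : pred T) (F : T -> nat) (j : T) :
  P j -> (\big[minn/x]_(i | P i) F i <= F j)%N.
Proof.
move=> Pj; rewrite -big_filter.
have: j \in [seq i <- index_enum T | P i] by rewrite mem_filter Pj mem_index_enum.
elim: filter => // a s IHs; rewrite inE big_cons geq_min.
by case/predU1P => [<- | /IHs ->]; rewrite ?leqnn ?orbT.
Qed.

(** The initial value [x] may survive as the minimum, so each use below has to deal with that case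
    separately. *)
Lemma bigminn_attained (T : finType) (x : nat) (P : pred T) (F : T -> nat) :
  \big[minn/x]_(i | P i) F i = x \/
  exists2 j, P j & \big[minn/x]_(i | P i) F i = F j.
Proof.
elim/big_ind: _ => [|a b IHa IHb|j Pj]; [by left| |by right; exists j].
by rewrite /minn; case: ifP.
Qed.

Section UnrejectedSets.
Variables (R : realType) (n : nat).
Variables (f : combining_function R) (alpha : R) (p : 'I_n -> R).
Hypothesis alpha_lt1 : alpha < 1.
Implicit Types A I J K : {set 'I_n}.

Definition adapt K := (~: K :&: Sminus p) :|: (K :&: Splus p).

Lemma in_Splus i : (i \in Splus p) = (i \notin Sminus p).
Proof. by rewrite !inE ltNge. Qed.

(** As [Splus p] is the complement of [Sminus p], [adapt K] is the symmetric difference of [K] and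
    [Sminus p]. *)
Lemma in_adapt K i : (i \in adapt K) = (i \in K) (+) (i \in Sminus p).
Proof.
by rewrite !in_setU !in_setI in_Splus in_setC; do 2 case: (_ \in _).
Qed.

Lemma adaptK : involutive adapt.
Proof. by move=> K; apply/setP => i; rewrite !in_adapt addbK. Qed.

Lemma phi_set0 : phi f alpha p set0 = 0%N.
Proof.
(* The arity of [f] depends on [s], so the substitution is made for a variable [s]. *)
have f_nil s : s = [::] -> f _ (in_tuple s) = 1.
  by move->; rewrite -(combine_nil f); congr (f _ _); apply: val_inj.
by rewrite /phi f_nil ?leNgt ?alpha_lt1 // /local_args !set0I enum_set0.
Qed.

Lemma phi_barP I :
  reflect (exists2 A : {set 'I_n}, I \subset A & phi f alpha p A = 0%N)
          (phi_bar f alpha p I == 0%N).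
Proof.
apply: (iffP eqP) => [phi0 | [A sIA phiA]].
  have [|[A sIA]] := bigminn_attained 1
      (fun A : {set 'I_n} => I \subset A) (phi f alpha p).
    by rewrite -/(phi_bar f alpha p I) phi0.
  by rewrite -/(phi_bar f alpha p I) phi0 => phiA; exists A.
by apply/eqP; rewrite -leqn0 -phiA; apply: bigminn_leq.
Qed.

(** The set [I :&: A] competes in the minimum, since its superset [A] is not rejected, and it misses
    the same elements of [I] as [A]. *)
Lemma ell_leq I A :
  phi f alpha p A = 0%N -> (ell f alpha p I <= #|I :\: A|)%N.
Proof.
move=> phiA; have -> : I :\: A = I :\: (I :&: A) by rewrite setDIr setDv set0U.
apply: (bigminn_leq #|I| (fun J : {set 'I_n} => #|I :\: J|)).
by rewrite subsetIl; apply/phi_barP; exists A; rewrite // subsetIr.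
Qed.

Lemma ell_attained I :
  exists2 A, phi f alpha p A = 0%N & ell f alpha p I = #|I :\: A|.
Proof.
have [ellE | [J /andP[_ /phi_barP[A sJA phiA]] ellE]] := bigminn_attained #|I|
  (fun J : {set 'I_n} => (J \subset I) && (phi_bar f alpha p J == 0%N))
  (fun J : {set 'I_n} => #|I :\: J|).
  (* The initial value [#|I|] is itself realized by the unrejected [set0]. *)
  by exists set0; rewrite ?phi_set0 // setD0.
(* Enlarging the minimizer [J] to [A] can only shrink the difference, and minimality forbids a
   strict decrease. *)
exists A => //; apply/eqP; rewrite eqn_leq ell_leq //=.
by rewrite [leqRHS]ellE subset_leq_card // setDS.
Qed.

Lemma NplusP I (v : 'I_(#|I|.+1)) :
  reflect (exists2 A, phi f alpha p A = 0%N & v = #|adapt A :&: I| :> nat)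
          (v \in Nplus f alpha p I).
Proof.
rewrite inE; apply: (iffP eqP) => [psi0 | [A phiA vE]].
  have [|[K /eqP vE]] :=
      bigminn_attained 1 (fun K : {set 'I_n} => #|K :&: I| == v) (psi f alpha p).
    by rewrite -/(psi_count f alpha p v I) psi0.
  rewrite -/(psi_count f alpha p v I) psi0 => psiK.
  by exists (adapt K); rewrite ?adaptK.
(* By involutivity [phi] at [A] is [psi] at [adapt A], so [K = adapt A] is the witness. *)
apply/eqP; rewrite -leqn0 -phiA -[A in phi _ _ _ A]adaptK.
by apply: (bigminn_leq 1 (psi f alpha p)); rewrite vE.
Qed.

Lemma adapt_in_Nplus I A : phi f alpha p A = 0%N ->
  exists2 v : 'I_(#|I|.+1), v \in Nplus f alpha p I & v = #|adapt A :&: I| :> nat.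
Proof.
move=> phiA; have ltv : (#|adapt A :&: I| < #|I|.+1)%N.
  by rewrite ltnS subset_leq_card ?subsetIr.
by exists (Ordinal ltv) => //; apply/NplusP; exists A.
Qed.

Lemma tell_plus_leq I A :
  phi f alpha p A = 0%N -> (tell_plus f alpha p I <= #|adapt A :&: I|)%N.
Proof. by case/(adapt_in_Nplus I) => v vN <-; apply: bigminn_leq. Qed.

Lemma tell_plus_attained I :
  exists2 A, phi f alpha p A = 0%N & tell_plus f alpha p I = #|adapt A :&: I|.
Proof.
have [tellE | [v /NplusP[A phiA vE] tellE]] := bigminn_attained #|I|
  (fun v => v \in Nplus f alpha p I) (@nat_of_ord _); last first.
  by exists A => //; rewrite -vE.
(* If the minimum is the initial value [#|I|], then [set0] attains it, as its count is at most
   [#|I|]. *)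
exists set0; rewrite ?phi_set0 //; apply/eqP.
rewrite eqn_leq tell_plus_leq ?phi_set0 //=.
by rewrite [leqRHS]tellE subset_leq_card ?subsetIr.
Qed.

Lemma tell_minus_leq I A :
  phi f alpha p A = 0%N -> (tell_minus f alpha p I <= #|I :\: adapt A|)%N.
Proof.
case/(adapt_in_Nplus I) => v vN vE.
by rewrite cardsD setIC -vE leq_sub2l //; apply: leq_bigmax_cond.
Qed.

Lemma tell_minus_attained I :
  exists2 A, phi f alpha p A = 0%N & tell_minus f alpha p I = #|I :\: adapt A|.
Proof.
have [v0 v0N _] := adapt_in_Nplus I phi_set0.
have Nplus_gt0 : (0 < #|Nplus f alpha p I|)%N by apply/card_gt0P; exists v0.
have [v /NplusP[A phiA vE] maxE] := eq_bigmax_cond (@nat_of_ord _) Nplus_gt0.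
by exists A; rewrite // /tell_minus maxE vE setIC cardsD.
Qed.

Lemma ell_plus_leq_tell_plus I : (ell_plus f alpha p I <= tell_plus f alpha p I)%N.
Proof.
have [A phiA ->] := tell_plus_attained I.
(* On [Sminus p], lying outside [A] means lying in [adapt A]. *)
apply: leq_trans (ell_leq _ phiA) (subset_leq_card _); apply/subsetP => i.
rewrite in_setD !in_setI in_adapt.
by do 3 case: (_ \in _).
Qed.

Lemma ell_minus_leq_tell_minus I :
  (ell_minus f alpha p I <= tell_minus f alpha p I)%N.
Proof.
have [A phiA ->] := tell_minus_attained I.
(* On [Splus p], [A] and [adapt A] have the same elements. *)
apply: leq_trans (ell_leq _ phiA) (subset_leq_card _); apply/subsetP => i.
rewrite !in_setD in_setI in_adapt in_Splus.
by do 3 case: (_ \in _).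
Qed.

Lemma tell_plus_Sminus I :
  I \subset Sminus p -> tell_plus f alpha p I = ell_plus f alpha p I.
Proof.
move=> sI; apply/eqP; rewrite eqn_leq ell_plus_leq_tell_plus andbT.
rewrite /ell_plus (setIidPl sI); have [A phiA ->] := ell_attained I.
apply: leq_trans (tell_plus_leq _ phiA) (subset_leq_card _); apply/subsetP => i.
rewrite in_setD in_setI in_adapt => /andP[+ iI].
by rewrite iI (subsetP sI) // addbT => ->.
Qed.

Lemma tell_minus_Splus I :
  I \subset Splus p -> tell_minus f alpha p I = ell_minus f alpha p I.
Proof.
move=> sI; apply/eqP; rewrite eqn_leq ell_minus_leq_tell_minus andbT.
rewrite /ell_minus (setIidPl sI); have [A phiA ->] := ell_attained I.
apply: leq_trans (tell_minus_leq _ phiA) (subset_leq_card _); apply/subsetP => i.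
rewrite !in_setD in_adapt => /andP[+ iI].
by have := subsetP sI i iI; rewrite in_Splus iI => /negbTE ->; rewrite addbF => ->.
Qed.

(** The unrejected [set0] has [adapt set0 = Sminus p], which covers [I]. *)
Lemma tell_minus_Sminus I : I \subset Sminus p -> tell_minus f alpha p I = 0%N.
Proof.
move=> sI; apply/eqP; rewrite -leqn0 (leq_trans (tell_minus_leq I phi_set0)) //.
rewrite leqn0 cards_eq0 setD_eq0; apply/subsetP => i iI.
by rewrite in_adapt in_set0 (subsetP sI).
Qed.

(** Here [adapt set0 = Sminus p] is disjoint from [I]. *)
Lemma tell_plus_Splus I : I \subset Splus p -> tell_plus f alpha p I = 0%N.
Proof.
move=> sI; apply/eqP; rewrite -leqn0 (leq_trans (tell_plus_leq I phi_set0)) //.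
rewrite leqn0 cards_eq0; apply/eqP/setP => i; rewrite in_setI in_adapt !in_set0 addFb.
by apply/negbTE/negP => /andP[iS /(subsetP sI)]; rewrite in_Splus iS.
Qed.

End UnrejectedSets.

Theorem proposition4p3 (R : realType) (n : nat)
    (f : combining_function R) (alpha : R) (p : 'I_n -> R)
    (hA0 : A0 f)
    (halpha : 0 < alpha < 1)
    (hp : forall i : 'I_n, 0 <= p i <= 1) :
  forall I : {set 'I_n},
    [/\ (ell_plus f alpha p I <= tell_plus f alpha p I)%N,
        (ell_minus f alpha p I <= tell_minus f alpha p I)%N,
        (I \subset Sminus p ->
           [/\ tell_plus f alpha p I = ell_plus f alpha p I,
               tell_minus f alpha p I = ell_minus f alpha p I
             & ell_minus f alpha p I = 0%N])
      & (I \subset Splus p ->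
           [/\ tell_minus f alpha p I = ell_minus f alpha p I,
               tell_plus f alpha p I = ell_plus f alpha p I
             & ell_plus f alpha p I = 0%N])].
Proof.
move=> I; have /andP[_ alpha_lt1] := halpha.
split=> [||sI|sI].
- exact: ell_plus_leq_tell_plus.
- exact: ell_minus_leq_tell_minus.
- have tell0 : tell_minus f alpha p I = 0%N by apply: tell_minus_Sminus.
  (* The smaller bound vanishes together with the larger one. *)
  have ell0 : ell_minus f alpha p I = 0%N.
    by apply/eqP; rewrite -leqn0 -tell0 ell_minus_leq_tell_minus.
  by rewrite tell0 ell0 tell_plus_Sminus.
- have tell0 : tell_plus f alpha p I = 0%N by apply: tell_plus_Splus.
  have ell0 : ell_plus f alpha p I = 0%N.
    by apply/eqP; rewrite -leqn0 -tell0 ell_plus_leq_tell_plus.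
  by rewrite tell0 ell0 tell_minus_Splus.
Qed.
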